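(* Let $K$ be the class of cotorsionfree abelian groups. There is no class $C$ of abelian groups such that $K={}^\perp C$.
   Context: For a class $C$ of abelian groups, ${}^\perp C=\{G : G \text{ an abelian group and } \mathrm{Ext}(G,X)=0\text{ for all }X\in C\}$. A group $G$ is cotorsion if $\mathrm{Ext}(J,G)=0$ for every torsionfree abelian group $J$; it is cotorsionfree if it has no nonzero cotorsion subgroup (equivalently, no subgroup isomorphic to $\mathbb{Q}$, $\mathbb{Z}/p\mathbb{Z}$ or the $p$-adic integers $J_p$, for any prime $p$). *)

(* Defs.v *)
From HB Require Import structures.
From mathcomp Require Import all_boot all_algebra ring_quotient.
From mathcomp Require Import boolp functions.

Set Implicit Arguments.
Unset Strict Implicit.
Unset Printing Implicit Defensive.

Import GRing.Theory.
Local Open Scope ring_scope.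

(* Ext(G, X) for abelian groups, by factor sets: symmetric 2-cocycles
   G x G -> X modulo the coboundaries of arbitrary functions G -> X.  Neither
   the cocycles nor the functions are normalized at 0; this does not change the
   quotient, since every cocycle differs from a normalized one by the
   coboundary of a constant. *)

Section Ext.
Variables G X : zmodType.

Definition is_factor_set (f : G -> G -> X) : Prop :=
  (forall u v, f u v = f v u) /\
  (forall u v w, f u v + f (u + v) w = f v w + f u (v + w)).

Definition factor_pred : pred (G -> G -> X) := fun f => `[< is_factor_set f >].

Lemma factor_pred_closed : zmod_closed factor_pred.
Proof.
split=> [|f g /asboolP[fC fA] /asboolP[gC gA]]; apply/asboolP.
  by split=> // u v w; rewrite !addr0.
split=> [u v|u v w]; rewrite !fctE /=; first by rewrite fC gC.
by rewrite addrACA fA -opprD gA opprD addrACA.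
Qed.

HB.instance Definition _ :=
  GRing.isZmodClosed.Build (G -> G -> X) factor_pred factor_pred_closed.

Definition factor_set := {f : G -> G -> X | f \in factor_pred}.

HB.instance Definition _ := SubChoice.on factor_set.
HB.instance Definition _ := [SubChoice_isSubZmodule of factor_set by <:].

Definition coboundary (g : G -> X) : G -> G -> X :=
  fun u v => g u + g v - g (u + v).

Definition transformation_pred : pred factor_set :=
  fun f => `[< exists g : G -> X, val f = coboundary g >].

Lemma transformation_pred_closed : zmod_closed transformation_pred.
Proof.
split=> [|f f' /asboolP[g fE] /asboolP[g' f'E]]; apply/asboolP.
  exists (fun=> 0); rewrite raddf0.
  by apply/funext=> u; apply/funext=> v; rewrite /coboundary addr0 subr0.
exists (fun u => g u - g' u); rewrite raddfB /= fE f'E.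
apply/funext=> u; apply/funext=> v; rewrite !fctE /= /coboundary.
by rewrite opprD addrACA -opprD [- (g' u + _)]opprD [in LHS]addrACA.
Qed.

HB.instance Definition _ :=
  GRing.isZmodClosed.Build factor_set transformation_pred
    transformation_pred_closed.

Definition Ext : zmodType :=
  Quotient.quot (GRing.ZmodClosed.clone _ transformation_pred _).

Definition Ext_vanishes : Prop := forall e : Ext, e = 0.

End Ext.

Definition torsionfree (J : zmodType) : Prop :=
  forall (x : J) (n : nat), (0 < n)%N -> x *+ n = 0 -> x = 0.

Definition cotorsion (G : zmodType) : Prop :=
  forall J : zmodType, torsionfree J -> Ext_vanishes J G.

Section Subgroup.
Variables (G : zmodType) (H : zmodClosed G).

Definition subgroup := {x : G | x \in H}.

HB.instance Definition _ := SubChoice.on subgroup.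
HB.instance Definition _ := [SubChoice_isSubZmodule of subgroup by <:].

End Subgroup.

Definition cotorsionfree (G : zmodType) : Prop :=
  forall H : zmodClosed G, cotorsion (subgroup H) -> forall x, x \in H -> x = 0.

(* Isomorphism invariance is not imposed on classes. *)
Definition group_class := zmodType -> Prop.

Definition left_perp (C : group_class) : group_class :=
  fun G => forall X : zmodType, C X -> Ext_vanishes G X.

(* Main.v *)
Require Import Defs.
From HB Require Import structures.
From mathcomp Require Import all_boot all_order all_algebra ring_quotient.
From mathcomp Require Import boolp classical_sets functions cardinality fsbigop.
From mathcomp Require Import zify.

(* Suppose K = perp C.  As Q is divisible, it is cotorsion, hence not in K, so
   Ext(Q, X) <> 0 for some X in C; it suffices to find a cotorsionfree G with
   Ext(G, X) <> 0.  Take the tree whose nodes of height n are chosen so that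
   every function F from the nodes to X codes itself as a branch b_F, distinct
   functions having almost disjoint branches.  Let G be the group of integer
   vectors x on the nodes such that x(b_F(n)) = q_F n! for large n, with a
   rational q_F that is zero for almost all F.  Being a subgroup of a power of
   Z, G is cotorsionfree.  Any factor sets c_F on Q add up, through the
   projections x |-> q_F, to a factor set on G.  If t : G -> X trivialises it,
   then t restricts to a homomorphism on the free group of the nodes, given by
   F := t on unit vectors; on the vectors floor(q n!) along b_F, t then
   trivialises c_F + kappa_F, where kappa_F depends only on F.  Choosing c_F
   in advance, for each F, so that c_F + kappa_F is not trivial makes the
   factor set on G nontrivial. *)

Set Implicit Arguments.
Unset Strict Implicit.
Unset Printing Implicit Defensive.
Import GRing.Theory Num.Theory.
Local Open Scope classical_set_scope.
Local Open Scope ring_scope.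

(** * Ext in terms of factor sets *)

Lemma Ext_vanishesP (G X : zmodType) :
  Ext_vanishes G X <->
  forall f : G -> G -> X, is_factor_set f -> exists g, f = coboundary g.
Proof.
have Ext0 (f : factor_set G X) :
    \pi_(Ext G X)%qT f = 0 <-> exists g, val f = coboundary g.
  rewrite -(raddf0 (\pi_(Ext G X)%qT)).
  split=> [/eqP|fE]; last apply/eqP.
    by rewrite /Ext -Quotient.idealrBE subr0 => /asboolP.
  by rewrite /Ext -Quotient.idealrBE subr0; apply/asboolP.
split=> [E0 f /asboolP fP|dP e].
  exact: (Ext0 (exist _ f fP)).1 (E0 _).
by elim/quotW: e => f; apply/Ext0/dP/asboolP/(valP f).
Qed.

Lemma coboundaryP (G X : zmodType) (f : G -> G -> X) (g : G -> X) :
  f = coboundary g <-> forall u v, g u + g v = f u v + g (u + v).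
Proof.
split=> [-> u v|fE]; first by rewrite subrK.
by apply/funext=> u; apply/funext=> v; rewrite /coboundary fE addrK.
Qed.

Lemma coboundary_factor_set (G X : zmodType) (g : G -> X) :
  is_factor_set (coboundary g).
Proof.
split=> [u v|u v w]; rewrite /coboundary.
  by rewrite (addrC u) (addrC (g u)).
rewrite -[g (u + v) + _ - _]addrA subrKA (addrC (g u) (g (v + w))).
by rewrite -[g (v + w) + _ - _]addrA subrKA [RHS]addrCA -!addrA.
Qed.

(** * The group extension attached to a factor set *)

Section Twisted.
Variables (J D : zmodType) (f : J -> J -> D).

(* The extension of [J] by [D] given by [f]; the fibre coordinate of its zero is
   [f 0 0], as [f] is not normalized. *)
Definition twisted (fP : is_factor_set f) : Type := (D * J)%type.

Variable fP : is_factor_set f.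
Implicit Types a b c : twisted fP.

HB.instance Definition _ := Choice.copy (twisted fP) (D * J)%type.

Let add a b : twisted fP := (a.1 + b.1 - f a.2 b.2, a.2 + b.2).
Let zero : twisted fP := (f 0 0, 0).
Let opp a : twisted fP := (f 0 0 + f a.2 (- a.2) - a.1, - a.2).

Lemma factor_set0 u : f 0 u = f 0 0.
Proof.
by have [_ /(_ 0 0 u)] := fP; rewrite !add0r => /addIr.
Qed.

Let addA : associative add.
Proof.
move=> [x u] [y v] [z w]; rewrite /add/=; congr pair; last exact: addrA.
rewrite -!addrA; congr (_ + (_ + _)).
by rewrite [RHS]addrCA; congr (_ + _); rewrite -!opprD fP.2.
Qed.

Let addC : commutative add.
Proof.
by move=> [x u] [y v]; rewrite /add/= (addrC x) (addrC u) fP.1.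
Qed.

Let add0 : left_id zero add.
Proof.
by move=> [x u]; rewrite /add/= factor_set0 add0r addrAC subrr add0r.
Qed.

Let addN : left_inverse zero opp add.
Proof.
by move=> [x u]; rewrite /add/opp/zero/= subrK addNr fP.1 addrK.
Qed.

HB.instance Definition _ :=
  GRing.isZmodule.Build (twisted fP) addA addC add0 addN.

Lemma twistedD a b : a + b = (a.1 + b.1 - f a.2 b.2, a.2 + b.2).
Proof. by []. Qed.

Definition twisted_proj a : J := a.2.

Lemma twisted_proj_is_nmod : nmod_morphism twisted_proj.
Proof. by []. Qed.

HB.instance Definition _ :=
  GRing.isNmodMorphism.Build (twisted fP) J twisted_proj twisted_proj_is_nmod.

Definition twisted_inj (x : D) : twisted fP := (x + f 0 0, 0).

Lemma twisted_inj_is_nmod : nmod_morphism twisted_inj.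
Proof.
split=> [|x y]; first by rewrite /twisted_inj add0r.
rewrite /twisted_inj twistedD/= addr0; congr pair.
by rewrite addrACA addrA addrK.
Qed.

HB.instance Definition _ :=
  GRing.isNmodMorphism.Build D (twisted fP) twisted_inj twisted_inj_is_nmod.

End Twisted.

(** * Vanishing of Ext into divisible groups *)

Lemma int_subgroup_principal (I : int -> Prop) :
  I 0 -> (forall m n, I m -> I n -> I (m - n)) ->
  exists2 n : nat, I n & forall m, I m -> (n %| m)%Z.
Proof.
move=> I0 IB.
have IN m : I m -> I (- m) by move=> Im; rewrite -sub0r; apply: IB.
have ID m n : I m -> I n -> I (m + n).
  by move=> Im In; rewrite -[n]opprK; apply/IB/IN.
have IM m k : I m -> I (m * k).
  move=> Im; have IMn (i : nat) : I (m * i).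
    by elim: i => [|i IHi]; rewrite ?mulr0// intS mulrDr mulr1; apply: ID.
  by case: (intP k) => [|n|n]; rewrite ?mulr0 ?mulrN //; apply/IN.
have [[n n_gt0 In]|I_le0] :=
  pselect (exists2 n : nat, (0 < n)%N & I n); last first.
  exists 0%N => // m Im; rewrite dvd0z; apply/eqP.
  case: (intP m) Im => [//|n|n]; first by move=> ?; case: I_le0; exists n.+1.
  by move=> /IN; rewrite opprK => ?; case: I_le0; exists n.+1.
pose P n := `[< (0 < n)%N /\ I n >].
have exP : exists n, P n by exists n; apply/asboolP.
case: (ex_minnP exP) => d /asboolP[d_gt0 Id] d_min; exists d => // m Im.
have Im' : I (m %% d)%Z.
  by rewrite /modz mulrC; apply/IB/IM.
apply/dvdz_mod0P; apply: contraPeq Im' => m'_neq0 Im'.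
have m'_ge0 : 0 <= (m %% d)%Z by rewrite modz_ge0; lia.
have m'_lt : (m %% d)%Z < d by rewrite ltz_pmod.
have /d_min : P `|(m %% d)%Z|%N.
  by apply/asboolP; split; [lia | rewrite gez0_abs].
lia.
Qed.

(** Zorn gives a maximal [M] meeting the kernel trivially; divisibility of the kernel forces it to
    reach the whole image of [p]. *)
Lemma divisible_kernel_complement (E J : zmodType) (p : {additive E -> J}) :
    (forall e n, (0 < n)%N -> p e = 0 -> exists2 e', p e' = 0 & e' *+ n = e) ->
  exists M : set E, [/\ forall x y, M x -> M y -> M (x - y),
    forall x, M x -> p x = 0 -> x = 0 & forall e, exists2 m, M m & p m = p e].
Proof.
move=> p_div.
pose P (M : set E) := (forall x y, M x -> M y -> M (x - y)) /\
  (forall x, M x -> p x = 0 -> x = 0).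
have [|M [[MB Mp] Mmax]] := @Zorn_bigcup E P.
  move=> F FP Ftot; split=> [x y [A FA Ax] [B FB By]|x [A FA Ax]].
    have [AB|BA] := Ftot _ _ FA FB.
      by exists B => //; apply: (FP _ FB).1 => //; apply: AB.
    by exists A => //; apply: (FP _ FA).1 => //; apply: BA.
  exact: (FP _ FA).2.
(* [P] also holds for the empty set, the union of the empty chain; maximality excludes it, since
   [{0}] is larger. *)
have M0 : M 0.
  apply: contrapT => nM0; apply: (Mmax [set 0]%classic).
    split=> [x Mx|/(_ 0 erefl)//].
    by case: nM0; rewrite -(subrr x); apply: MB.
  split=> [x y /= -> ->|x //]; by rewrite subrr.
have MN x : M x -> M (- x) by move=> Mx; rewrite -sub0r; apply: MB.
have MD x y : M x -> M y -> M (x + y).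
  by move=> Mx My; rewrite -[y]opprK; apply/MB/MN.
have MMn x n : M x -> M (x *+ n).
  by move=> Mx; elim: n => [|n IHn]; rewrite ?mulr0n// mulrS; apply: MD.
have MMz x (k : int) : M x -> M (x *~ k).
  by move=> Mx; case: k => n; [apply: MMn | apply/MN/MMn].
exists M; split=> // e.
(* Such an [e'] can be added to [M] without meeting the kernel of [p]. *)
suff [e' pe' e'M] : exists2 e', p e' = p e &
    forall k : int, (exists2 m, M m & p m = p e *~ k) -> M (e' *~ k).
  exists e' => //; apply: contrapT => nMe'.
  apply: (Mmax
    [set x | exists2 m, M m & exists k : int, x = m + e' *~ k]%classic).
    split=> [x Mx|]; first by exists x => //; exists 0; rewrite mulr0z addr0.
    move=> BM; apply/nMe'/BM.
    by exists 0 => //; exists 1; rewrite mulr1z add0r.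
  split=> [_ _ [m Mm [k ->]] [n Mn [l ->]]|_ [m Mm [k ->]]].
    exists (m - n); first exact: MB.
    by exists (k - l); rewrite mulrzBr opprD addrACA.
  rewrite raddfD raddfMz/= pe' => pm0; apply: Mp; last first.
    by rewrite raddfD raddfMz/= pe'.
  apply: MD => //; apply: e'M; exists (- m); first exact: MN.
  by rewrite raddfN/= -[LHS]addr0 -pm0 addKr.
(* The multiples of [p e] reached by [M] are those by multiples of one [n]. If [n > 0], dividing the
   kernel element [e *+ n - m] by [n] and subtracting the quotient from [e] gives [e'] with
   [e' *+ n = m]. *)
pose I k := exists2 m, M m & p m = p e *~ k.
have I0 : I 0 by exists 0 => //; rewrite raddf0 mulr0z.
have IB k l : I k -> I l -> I (k - l).
  move=> [m Mm pm] [n Mn pn]; exists (m - n); first exact: MB.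
  by rewrite raddfB/= pm pn mulrzBr.
have [n [m Mm pm] nP] := int_subgroup_principal I0 IB.
have [n0|n_gt0] := posnP n.
  by exists e => // k /nP; rewrite n0 dvd0z => /eqP->; rewrite mulr0z.
have [|c pc cE] := p_div (e *+ n - m) n n_gt0.
  by rewrite raddfB raddfMn/= pm subrr.
exists (e - c); first by rewrite raddfB/= pc subr0.
move=> k /nP/dvdzP[l ->]; rewrite mulrC mulrzA; apply: MMz.
by rewrite -pmulrn mulrnBl cE subKr.
Qed.

(** A complement of the fibre in the extension is the image of a homomorphic section, whose fibre
    coordinate has coboundary [f]. *)
Lemma divisible_Ext_vanishes (J D : zmodType) :
  (forall (x : D) n, (0 < n)%N -> exists y, y *+ n = x) -> Ext_vanishes J D.
Proof.
move=> D_div; apply/Ext_vanishesP => f fP.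
have [|M [MB Mp Mfull]] :=
    @divisible_kernel_complement (twisted fP) J (@twisted_proj J D f fP).
  move=> [x u] n n_gt0 /= u0; have [y yE] := D_div (x - f 0 0) n n_gt0.
  exists (twisted_inj fP y) => //.
  by rewrite -raddfMn yE /= /twisted_inj subrK [u]u0.
have /boolp.choice[s sP] u : exists m : twisted fP, M m /\ m.2 = u.
  by have [m Mm mu] := Mfull (0, u); exists m.
exists (fun u => (s u).1); apply/coboundaryP => u v.
have MD x y : M x -> M y -> M (x + y).
  move=> Mx My; rewrite -[y]opprK; apply: (MB) => //.
  by rewrite -sub0r -(subrr y); apply: (MB) => //; apply: (MB).
have [[[Mu su] [Mv sv]] [Muv suv]] := (sP u, sP v, sP (u + v)).
have /eqP : s u + s v - s (u + v) = 0.
  apply: Mp; first by apply: (MB) => //; apply: MD.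
  by rewrite raddfB raddfD/= /twisted_proj su sv suv subrr.
rewrite subr_eq0 => /eqP/(congr1 fst) <-.
by rewrite twistedD/= su sv [RHS]addrC subrK.
Qed.

(** * Divergent factorial series on the rationals *)

Section FactorialSums.
Variable X : zmodType.
Implicit Types (a : nat -> X) (q r : rat).

Definition floor_sum a N q : X := \sum_(n < N) a n *~ Num.floor (q * n`!%:R).

(* The coboundary of the divergent series [\sum_n a n *~ floor (q * n!)]: by
   [kappaE] the terms with [q * n!] integral cancel out. *)
Definition kappa a q r : X := coboundary (floor_sum a `|denq q|%N) q r.

Lemma int_mul_fact q : q * (`|denq q|%N)`!%:R \is a Num.int.
Proof.
have /dvdnP[k ->] : (`|denq q| %| (`|denq q|)`!)%N.
  by rewrite dvdn_fact// leqnn absz_gt0 denq_neq0.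
rewrite natrM mulrCA natr_absz gtr0_norm ?denq_gt0//.
rewrite -{1}[q]divq_num_den divfK ?intr_eq0 ?denq_neq0//.
by rewrite rpredM ?natr_int ?intr_int.
Qed.

Lemma int_mul_factW q m n : (m <= n)%N ->
  q * m`!%:R \is a Num.int -> q * n`!%:R \is a Num.int.
Proof.
by move=> le_mn qm; rewrite (fact_split le_mn) natrM mulrA rpredM ?natr_int.
Qed.

Lemma floor_mul_fact_add q r n : q * n`!%:R \is a Num.int ->
  Num.floor ((q + r) * n`!%:R) =
    Num.floor (q * n`!%:R) + Num.floor (r * n`!%:R).
Proof. by move=> qn; rewrite mulrDl floorDzr. Qed.

Lemma kappaE a q r N : q * N`!%:R \is a Num.int ->
  kappa a q r = coboundary (floor_sum a N) q r.
Proof.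
have stable m n : (m <= n)%N -> q * m`!%:R \is a Num.int ->
    coboundary (floor_sum a n) q r = coboundary (floor_sum a m) q r.
  move=> le_mn qm; elim: n le_mn => [|n IHn]; first by rewrite leqn0 => /eqP->.
  rewrite leq_eqVlt => /predU1P[<-//|le_mn].
  rewrite -IHn// /coboundary /floor_sum !big_ord_recr/=.
  rewrite (floor_mul_fact_add _ (@int_mul_factW _ m n le_mn qm)) mulrzDr.
  by rewrite addrACA (addrC (bigop _ _ _) (_ + _)) addrKA.
move=> qN; have qd := int_mul_fact q.
by have [le_dN|/ltnW le_Nd] := leqP `|denq q|%N N;
  [rewrite (stable _ _ le_dN) | rewrite /kappa (stable _ _ le_Nd)].
Qed.

(** One [N] clears all denominators involved, so the identities are inherited from a true
    coboundary. *)
Lemma kappa_factor_set a : is_factor_set (kappa a).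
Proof.
split=> [q r|q r s]; pose N := (`|denq q| + `|denq r| + `|denq (q + r)|)%N.
  rewrite !(@kappaE _ _ _ N); first exact: (coboundary_factor_set _).1.
    by apply: int_mul_factW (int_mul_fact _); lia.
  by apply: int_mul_factW (int_mul_fact _); lia.
rewrite !(@kappaE _ _ _ N); first exact: (coboundary_factor_set _).2.
all: by apply: int_mul_factW (int_mul_fact _); lia.
Qed.

(** Subtracting the first [n] terms of the series from [t] leaves a map additive on the multiples of
    [1/n!]. Its value at [1/n!] is [u n]; the next term of the series there is [a n]. *)
Lemma kappa_coboundary a t : kappa a = coboundary t ->
  exists u : nat -> X, forall n, u n = a n + u n.+1 *+ n.+1.
Proof.
move/coboundaryP => tE.
pose t_ N q := t q - floor_sum a N q.
have tD N q r : q * N`!%:R \is a Num.int -> t_ N (q + r) = t_ N q + t_ N r.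
  move=> qN; rewrite /t_ addrACA tE (kappaE _ _ qN) /coboundary.
  by rewrite -opprD [RHS]addrC -[X in _ = _ + X]addrA addKr addrC.
have tMn N q k : q * N`!%:R \is a Num.int -> t_ N (q *+ k.+1) = t_ N q *+ k.+1.
  by move=> qN; elim: k => // k IHk; rewrite mulrS tD// IHk -mulrS.
have factV n : (n`!%:R)^-1 * n`!%:R = 1 :> rat.
  by rewrite mulVf// pnatr_eq0 -lt0n fact_gt0.
exists (fun n => t_ n (n`!%:R)^-1) => n.
rewrite -tMn ?factV ?rpred1//.
have -> : (n.+1`!%:R)^-1 *+ n.+1 = (n`!%:R)^-1 :> rat.
  by rewrite factS natrM invfM -[LHS]mulr_natr mulrAC mulVf ?mul1r ?pnatr_eq0.
rewrite /t_ /floor_sum big_ord_recr/= factV floor1 mulr1z.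
by rewrite [RHS]addrC opprD addrA subrK.
Qed.

End FactorialSums.

(** * Cotorsionfreeness from homomorphisms to the integers *)

(** The factor [n.+1] shrinks [u]: its absolute values stay below [B] from index 1 on, so
    [|u n.+1| * n.+1] is at most [2B] and [u] is eventually zero. *)
Lemma factorial_divisibility (u : nat -> int) (d : int) :
  (forall n, u n = d + u n.+1 *+ n.+1) -> d = 0.
Proof.
move=> uE; pose v n := `|u n|%N; pose B := (v 1 + `|d|)%N.
have vS n : (v n.+1 * n.+1 <= v n + `|d|)%N.
  have -> : (v n.+1 * n.+1)%N = `|(u n - d)%R|%N.
    by rewrite uE addrAC subrr add0r -mulr_natr natz abszM.
  by rewrite /v; lia.
have vB n : (v n.+1 <= B)%N.
  elim: n => [|n IHn]; first exact: leq_addr.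
  by have := vS n.+1; rewrite /B in IHn *; nia.
have v0 n : (B.*2 < n.+2)%N -> u n.+2 = 0.
  move=> Bn; apply/eqP; rewrite -absz_eq0 -/(v _) -leqn0 leqNgt; apply/negP.
  by have := vS n.+1; have := vB n; rewrite /B in Bn *; nia.
by have := uE B.*2.+2; rewrite !v0 ?mul0rn ?addr0//; lia.
Qed.

Lemma torsionfree_rat : torsionfree rat.
Proof.
by move=> x n n_gt0 /eqP; rewrite mulrn_eq0 eqn0Ngt n_gt0 => /eqP.
Qed.

(** Cotorsion of [H] trivialises [kappa] with constant coefficient [x]; [h] maps the resulting
    equations to integer ones, which force [h x = 0]. *)
Lemma int_separated_cotorsionfree (G : zmodType) :
  (forall x : G, x <> 0 -> exists h : {additive G -> int}, h x <> 0) ->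
  cotorsionfree G.
Proof.
move=> sepG H /(_ _ torsionfree_rat)/Ext_vanishesP Hcot x Hx.
apply: contrapT => /sepG[h]; apply.
pose y : subgroup H := exist _ x Hx.
have [t /kappa_coboundary[u uE]] := Hcot _ (kappa_factor_set (fun=> y)).
apply: (@factorial_divisibility (fun n => h (val (u n)))) => n.
by rewrite {1}uE !raddfD !raddfMn.
Qed.

(** * The tree, its branches and the group of tame vectors *)

Section Tree.
Variable X : zmodType.

(* A node of height [n] records the restrictions of a function to all the
   levels below [n], so that [branch F n] determines [F] on these levels. *)
Fixpoint level n : Type :=
  if n is n'.+1 then (level n' * (level n' -> X))%type else unit.

Definition node : Type := {n & level n}.

Implicit Types (F : node -> X) (x : node -> int) (l : node) (q r : rat).

Fixpoint branch F n : level n :=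
  if n is n'.+1 return level n
  then (branch F n', fun l : level _ => F (existT level n' l))
  else tt.

Definition branch_node F n : node := existT level n (branch F n).

(** If [F] and [F'] differ at a node of height [k], all nodes above height [k] on the two branches
    record the difference. *)
Lemma branch_neq F F' : F <> F' ->
  exists N, forall n, (N <= n)%N -> branch F n <> branch F' n.
Proof.
move=> neqF; have [[k l] neqFkl] : exists l, F l <> F' l.
  by apply: contrapT => eqF; apply/neqF/funext => l;
    apply: contrapT => ?; apply: eqF; exists l.
exists k.+1; elim=> // n IHn; rewrite leq_eqVlt => /predU1P[[<-] [_]|kn [/IHn]].
  by move/(congr1 (@^~ l)).
exact.
Qed.

Definition growth (s : nat -> int) (q : rat) : Prop :=
  exists N, forall n, (N <= n)%N -> (s n)%:~R = q * n`!%:R.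

Lemma growthD s s' q q' :
  growth s q -> growth s' q' -> growth (fun n => s n + s' n) (q + q').
Proof.
move=> [N sq] [N' sq']; exists (N + N')%N => n le_n.
by rewrite intrD sq ?sq' ?mulrDl//; lia.
Qed.

Lemma growthN s q : growth s q -> growth (fun n => - s n) (- q).
Proof. by move=> [N sq]; exists N => n le_n; rewrite intrN sq ?mulNr. Qed.

Lemma growth_inj s q q' : growth s q -> growth s q' -> q = q'.
Proof.
move=> [N sq] [N' sq']; pose n := (N + N')%N.
have nfact0 : n`!%:R != 0 :> rat by rewrite pnatr_eq0 -lt0n fact_gt0.
by apply: (mulIf nfact0); rewrite -sq ?sq'//; lia.
Qed.

Lemma growth0 s N : (forall n, (N <= n)%N -> s n = 0) -> growth s 0.
Proof. by move=> s0; exists N => n /s0->; rewrite mul0r. Qed.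

(** The value is arbitrary if no such [q] exists; [tame] asks for growth with this very value and so
    ensures existence. *)
Definition limit F x : rat :=
  get [set q | growth (fun n => x (branch_node F n)) q].

Lemma limitP F x q : growth (fun n => x (branch_node F n)) q -> limit F x = q.
Proof.
move=> xq; apply: growth_inj (xq).
by apply: (getPex (P := [set q | growth _ q])); exists q.
Qed.

Definition tame : pred (node -> int) := fun x =>
  `[< (forall F, growth (fun n => x (branch_node F n)) (limit F x)) /\
      finite_set [set F | limit F x <> 0] >].

Lemma tameP x (q : (node -> X) -> rat) :
    (forall F, growth (fun n => x (branch_node F n)) (q F)) ->
    finite_set [set F | q F <> 0] -> x \in tame.
Proof.
move=> xq; have -> : q = limit^~ x
  by apply/funext => F; rewrite (limitP (xq F)).
by move=> xfin; apply/asboolP; split=> // F; rewrite (limitP (xq F)).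
Qed.

Lemma tame_closed : zmod_closed tame.
Proof.
split=> [|x y /asboolP[xP xfin] /asboolP[yP yfin]].
  apply: (@tameP _ (fun=> 0)) => [F|]; first exact: (@growth0 _ 0).
  by rewrite (_ : [set _ | _] = set0)//; apply/seteqP; split.
apply: (@tameP _ (fun F => limit F x - limit F y)) => [F|].
  exact/growthD/growthN.
have : finite_set ([set F | limit F x <> 0] `|` [set F | limit F y <> 0]).
  by rewrite finite_setU.
apply: sub_finite_set => F /=.
have [->|] := pselect (limit F x = 0); last by left.
by rewrite sub0r => neq0; right=> eq0; apply: neq0; rewrite eq0 oppr0.
Qed.

HB.instance Definition _ :=
  GRing.isZmodClosed.Build (node -> int) tame tame_closed.

Definition tame_group : zmodType := subgroup (GRing.ZmodClosed.clone _ tame _).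

Implicit Types g h : tame_group.

Definition coord l g : int := val g l.

Lemma coord_is_nmod l : nmod_morphism (coord l).
Proof. by split=> [|g h]; rewrite /coord ?raddf0 ?raddfD. Qed.

HB.instance Definition _ l :=
  GRing.isNmodMorphism.Build tame_group int (coord l) (coord_is_nmod l).

Lemma tame_group_ext g h : (forall l, coord l g = coord l h) -> g = h.
Proof. by move=> gh; apply/val_inj/funext. Qed.

Lemma tame_group_cotorsionfree : cotorsionfree tame_group.
Proof.
apply: int_separated_cotorsionfree => g g_neq0.
have [l gl] : exists l, coord l g <> 0.
  apply: contrapT => g0; apply/g_neq0/tame_group_ext => l; rewrite raddf0.
  by apply: contrapT => ?; apply: g0; exists l.
by exists (coord l).
Qed.

Definition slope F g : rat := limit F (val g).

Lemma slopeP F g : growth (fun n => val g (branch_node F n)) (slope F g).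
Proof. by have /asboolP[] := valP g. Qed.

Lemma slopeE F g q :
  growth (fun n => val g (branch_node F n)) q -> slope F g = q.
Proof. exact: limitP. Qed.

Lemma slopeD F g h : slope F (g + h) = slope F g + slope F h.
Proof.
by apply: slopeE; rewrite raddfD; exact: growthD (slopeP _ _) (slopeP _ _).
Qed.

Lemma slope_support g :
  exists s : seq (node -> X), forall F, F \notin s -> slope F g = 0.
Proof.
have /asboolP[_ /finite_seqP[s sE]] := valP g; exists s => F.
by apply: contraNeq => /eqP sF; have : [set` s] F by rewrite -sE.
Qed.

Lemma unit_vector_tame l : (fun l' => `[< l' = l >]%:R) \in tame.
Proof.
apply: (@tameP _ (fun=> 0)) => [F|].
  apply: (@growth0 _ (projT1 l).+1) => n ln; case: asboolP => // lE.
  by rewrite -lE ltnn in ln.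
by rewrite (_ : [set _ | _] = set0)//; apply/seteqP; split.
Qed.

Definition unit_vector l : tame_group :=
  exist (fun x => x \in tame) _ (unit_vector_tame l).

Lemma slope_unit_vector F l : slope F (unit_vector l) = 0.
Proof.
apply: slopeE; apply: (@growth0 _ (projT1 l).+1) => n ln /=.
by case: asboolP => // lE; rewrite -lE ltnn in ln.
Qed.

(** Cutting off the heights below [N] makes the vector additive in [q] once [q * N!] is an
    integer. *)
Definition branch_tail F N q l : int :=
  if `[< (N <= projT1 l)%N /\ projT2 l = branch F (projT1 l) >]
  then Num.floor (q * (projT1 l)`!%:R) else 0.

Lemma branch_tail_growth F N q F' :
  growth (fun n => branch_tail F N q (branch_node F' n))
    (if `[< F' = F >] then q else 0).
Proof.
case: asboolP => [->|/branch_neq[M neqM]].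
  exists (N + `|denq q|)%N => n le_n; rewrite /branch_tail/= ifT; last first.
    by apply/asboolP; split=> //; lia.
  apply/floorK/(int_mul_factW _ (int_mul_fact q)); lia.
apply: (@growth0 _ M) => n /neqM neq; rewrite /branch_tail/= ifF//.
by apply/asboolP => -[].
Qed.

Lemma branch_tail_tame F N q : branch_tail F N q \in tame.
Proof.
apply: tameP (branch_tail_growth F N q) _.
apply: (@sub_finite_set _ _ [set F]) (finite_set1 _) => F' /=.
by case: asboolP.
Qed.

Definition tail F N q : tame_group :=
  exist (fun x => x \in tame) _ (branch_tail_tame F N q).

Lemma slope_tail F N q F' :
  slope F' (tail F N q) = if `[< F' = F >] then q else 0.
Proof. exact/slopeE/branch_tail_growth. Qed.

Lemma tailS F N q :
  tail F N q =
    tail F N.+1 q + unit_vector (branch_node F N) *~ Num.floor (q * N`!%:R).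
Proof.
apply: tame_group_ext => l; rewrite raddfD raddfMz/= /coord/= /branch_tail.
have [lE|l_neq] := pselect (l = branch_node F N).
  rewrite lE/= (asboolT (erefl _)) ifT; last by apply/asboolP.
  rewrite ifF ?add0r; last by apply/asboolP => -[]; rewrite ltnn.
  by rewrite intz.
rewrite (asboolF l_neq) mul0rz addr0; congr (if _ then _ else _).
apply/asbool_equiv_eq; split=> -[Nl lb]; split=> //; last exact: ltnW.
rewrite ltn_neqAle Nl andbT; apply/eqP => NE; apply: l_neq.
by move: l lb NE {Nl} => [n b] /= -> ->.
Qed.

Lemma tailD F N q r : q * N`!%:R \is a Num.int ->
  tail F N (q + r) = tail F N q + tail F N r.
Proof.
move=> qN; apply: tame_group_ext => l; rewrite raddfD/= /coord/= /branch_tail.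
case: asboolP => // -[Nl _]; apply: floor_mul_fact_add.
exact: int_mul_factW qN.
Qed.

(** * A factor set on the tame group, summed over all branches *)

Section Cocycle.
Variable c : (node -> X) -> rat -> rat -> X.
Hypothesis c_factor : forall F, is_factor_set (c F).
Hypothesis c0 : forall F q, c F q 0 = 0.

Let c0l F q : c F 0 q = 0. Proof. by rewrite (c_factor F).1 c0. Qed.

(** The sum is finite: almost all slopes vanish, and [c F] is zero when one argument is. *)
Definition sum_cocycle g h : X :=
  \sum_(F \in [set: node -> X]) c F (slope F g) (slope F h).

Lemma sum_cocycleE (s : seq (node -> X)) g h : uniq s ->
    (forall F, F \notin s -> slope F g = 0 \/ slope F h = 0) ->
  sum_cocycle g h = \sum_(F <- s) c F (slope F g) (slope F h).
Proof.
move=> s_uniq s0; rewrite /sum_cocycle (fsbigE s)//.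
  by apply: eq_bigl => F; rewrite in_setT.
by move=> F _ /s0[] ->; rewrite ?c0 ?c0l.
Qed.

Lemma sum_cocycle_factor_set : is_factor_set sum_cocycle.
Proof.
split=> [g h|g h k].
  by apply: eq_fsbigr => F _; rewrite (c_factor F).1.
have [[sg sgP] [sh shP] [sk skP]] :=
  And3 (slope_support g) (slope_support h) (slope_support k).
pose s := undup (sg ++ sh ++ sk).
have s_uniq : uniq s := undup_uniq _.
have sP F : F \notin s -> [/\ slope F g = 0, slope F h = 0 & slope F k = 0].
  rewrite mem_undup !mem_cat !negb_or => /and3P[Fg Fh Fk].
  by split; [exact: sgP|exact: shP|exact: skP].
rewrite !(@sum_cocycleE s)//; try by move=> F /sP[? ? ?]; auto.
rewrite -!big_split/=; apply: eq_bigr => F _.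
by rewrite !slopeD (c_factor F).2.
Qed.

(* [F] is [t] on the unit vectors and [u q] is [t] on the vector with entries
   [floor (q * n!)] along the branch of [F]. *)
Lemma sum_cocycle_coboundary (t : tame_group -> X) :
    sum_cocycle = coboundary t ->
  exists F, exists u, forall q r,
    u q + u r = c F q r + kappa (fun n => F (branch_node F n)) q r + u (q + r).
Proof.
move/coboundaryP => tE; pose F l := t (unit_vector l); exists F.
(* The factor set vanishes against vectors with all slopes zero, in particular against unit
   vectors. *)
have tD0 g h : (forall F, slope F h = 0) -> t (g + h) = t g + t h.
  move=> h0; rewrite tE (@sum_cocycleE [::]) ?big_nil ?add0r// => F' _.
  by right.
have tMz g l k : t (g + unit_vector l *~ k) = t g + F l *~ k.
  have tMn g' n : t (g' + unit_vector l *+ n) = t g' + F l *+ n.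
    elim: n => [|n IHn]; first by rewrite !mulr0n !addr0.
    by rewrite !mulrSr !addrA tD0 ?IHn// => F'; exact: slope_unit_vector.
  case: k => n; first exact: tMn.
  by rewrite -[in RHS](subrK (unit_vector l *+ n.+1) g) tMn addrK.
(* The entries below height [N] contribute a partial floor sum, the source of [kappa]. *)
have t_tail N q : t (tail F 0 q) =
    t (tail F N q) + floor_sum (fun n => F (branch_node F n)) N q.
  elim: N => [|N IHN]; first by rewrite /floor_sum big_ord0 addr0.
  by rewrite IHN tailS tMz /floor_sum big_ord_recr/= addrAC addrA.
exists (fun q => t (tail F 0 q)) => q r.
have qN := int_mul_fact q; set N := `|denq q|%N in qN *.
(* From height [N] on the tails add exactly, and only the branch of [F] has nonzero slopes, which
   leaves [c F q r]. *)
rewrite !(t_tail N) (kappaE _ _ qN) addrACA tE tailD// (@sum_cocycleE [:: F])//.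
  have regroup (x y z v w : X) : x + y + (z + v) = x + (z + v - w) + (y + w).
    rewrite -!addrA; congr (_ + _).
    by rewrite (addrC y w) addKr (addrC y) -addrA.
  rewrite big_seq1 2!slope_tail (asboolT (erefl F)) /coboundary.
  exact: regroup.
move=> F'; rewrite inE => /eqP F'F; left.
by rewrite slope_tail asboolF.
Qed.

End Cocycle.
End Tree.

(** * From cotorsionfree groups to the rationals *)

Lemma Ext_rat_vanishes (X : zmodType) :
  (forall G, cotorsionfree G -> Ext_vanishes G X) -> Ext_vanishes rat X.
Proof.
move=> XP; apply/Ext_vanishesP => f fP; apply: contrapT => f_nontriv.
pose k (F : node X -> X) := kappa (fun n => F (branch_node F n)).
pose trivial (e : rat -> rat -> X) := exists u, e = coboundary u.
(* Subtracting the coboundary of a constant normalizes [f], as [sum_cocycle] requires. *)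
pose f0 q r := f q r - f 0 0.
have f0P : is_factor_set f0.
  split=> [q r|q r s]; rewrite /f0; first by rewrite (fP.1 q r).
  by rewrite addrACA (fP.2 q r s) addrACA.
(* Either way [c F + k F] is nontrivial: a nontrivial class plus a trivial one, or [k F] itself. *)
pose c F := if `[< trivial (k F) >] then f0 else fun _ _ => 0.
have cP F : is_factor_set (c F).
  by rewrite /c; case: ifP => // _; split=> [//|*]; rewrite addr0.
have c0 F q : c F q 0 = 0.
  rewrite /c; case: ifP => // _; rewrite /f0 (fP.1 q 0).
  by rewrite (factor_set0 fP q) subrr.
have /Ext_vanishesP/(_ _ (sum_cocycle_factor_set cP c0)) :=
  XP _ (@tame_group_cotorsionfree X).
case=> t /(sum_cocycle_coboundary cP c0)[F [u uE]].
have [[v vE]|k_nontriv] := pselect (trivial (k F)); last first.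
  apply: (k_nontriv); exists u; apply/coboundaryP => q r.
  by rewrite uE /c asboolF//= add0r.
(* [u] trivialises [f0 + k F] and [v] trivialises [k F]; the constant undoes the normalization. *)
apply: f_nontriv; exists (fun q => u q - v q + f 0 0); apply/coboundaryP => q r.
move/coboundaryP: vE => vE.
have regroup (a o z x y : X) :
    a - o + z + x - (z + y) + (o + o) = a + (x - y + o).
  by rewrite [a - o + z + x]addrAC addrKA -[_ - y]addrA addrACA subrK.
rewrite addrACA [X in X + _]addrACA -opprD vE uE /c asboolT; last first.
  by exists v; apply/coboundaryP.
exact: regroup.
Qed.

Theorem corollary2p2 :
  ~ exists C : group_class,
      forall G : zmodType, cotorsionfree G <-> left_perp C G.
Proof.
move=> [C CP].
have rat_cotorsionfree : cotorsionfree rat.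
  apply/CP => X CX; apply: Ext_rat_vanishes => G /CP; exact.
have T_closed : zmod_closed (predT : pred rat) by [].
pose T := GRing.isZmodClosed.Build rat predT T_closed.
pose H : zmodClosed rat := HB.pack (predT : pred rat) T.
have H_cot : cotorsion (subgroup H).
  move=> J _; apply: divisible_Ext_vanishes => -[x Hx] n n_gt0.
  exists (exist _ (x / n%:R) isT); apply/val_inj; rewrite raddfMn/=.
  by rewrite -[LHS]mulr_natr divfK// pnatr_eq0 -lt0n.
by have /eqP := rat_cotorsionfree H H_cot 1 isT; rewrite oner_eq0.
Qed.
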